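(* Let $G$ be a weighted directed graph and let $S_1\subseteq S_2\subseteq V(G)$ be two initial blue sets. Then the expected propagation times under randomized zero forcing satisfy $\operatorname{ept}_{\mathrm{rzf}}(G,S_1)\ge \operatorname{ept}_{\mathrm{rzf}}(G,S_2)$.
   Context: Randomized zero forcing (RZF): $G$ is a finite directed graph with nonnegative weights $w_{uv}$ on directed edges $(u,v)$, with $w_{uv}=0$ if there is no edge from $u$ to $v$. Start with blue set $B_0=S$. Given the blue set $B_t$, each white vertex $w\notin B_t$ independently becomes blue at round $t+1$ with probability $p_t(w)=\frac{\sum_{u\in B_t}w_{uw}}{\sum_{u\in V(G)}w_{uw}}$ if the denominator is positive, and $p_t(w)=0$ otherwise; blue vertices stay blue forever. Expected propagation time: if it is possible (with positive probability) to color all of $G$ blue starting from $S$, then $\operatorname{ept}_{\mathrm{rzf}}(G,S)$ is the expected value of $\tau=\min\{t: B_t=V(G)\}$; otherwise $\operatorname{ept}_{\mathrm{rzf}}(G,S)=\infty$. The inequality is between elements of $[0,\infty]$. *)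

(* Defs.v *)
From HB Require Import structures.
From mathcomp Require Import all_boot all_order all_algebra.
From mathcomp Require Import all_classical all_reals all_analysis.

Set Implicit Arguments.
Unset Strict Implicit.
Unset Printing Implicit Defensive.

Import Order.TTheory GRing.Theory Num.Theory.
Local Open Scope ring_scope.

(* Loops, and edges of weight 0, are allowed. *)
Record wdigraph (R : realType) (V : finType) := WDigraph {
  edge : rel V;
  weight : V -> V -> R;
  weight_ge0 : forall u v, 0 <= weight u v;
  weight_nonedge : forall u v, ~~ edge u v -> weight u v = 0
}.

(* p_t(v), as a function of the blue set B = B_t *)
Definition rzf_prob (R : realType) (V : finType) (G : wdigraph R V)
    (B : {set V}) (v : V) : R :=
  if 0 < \sum_(u : V) weight G u v
  then (\sum_(u in B) weight G u v) / (\sum_(u : V) weight G u v)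
  else 0.

(* The probability that the blue set B becomes exactly B' after one round: blue
   vertices stay blue, and the white ones turn blue independently. *)
Definition rzf_trans (R : realType) (V : finType) (G : wdigraph R V)
    (B B' : {set V}) : R :=
  if B \subset B'
  then \prod_(v in ~: B)
         (if v \in B' then rzf_prob G B v else 1 - rzf_prob G B v)
  else 0.

(* (B_t)_t is a realization, on the probability space (Omega, P), of randomized
   zero forcing on G with initial blue set S. The last field says that,
   conditionally on the whole history B_0, ..., B_t, the law of B_{t+1} is
   rzf_trans G B_t; the product form also makes sense for histories of
   probability 0. *)
Record rzf_process (R : realType) (V : finType) (G : wdigraph R V)
    (S : {set V}) (d : measure_display) (Omega : measurableType d)
    (P : probability Omega R) (B : nat -> Omega -> {set V}) : Prop :=
  RzfProcess {
  rzf_measurable : forall (t : nat) (A : {set V}),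
    measurable [set x | B t x = A]%classic;
  rzf_init : forall x : Omega, B 0%N x = S;
  rzf_step : forall (t : nat) (A : nat -> {set V}),
    (P [set x | forall s, (s <= t.+1)%N -> B s x = A s]%classic
     = P [set x | forall s, (s <= t)%N -> B s x = A s]%classic
       * (rzf_trans G (A t) (A t.+1))%:E)%E
}.

(* tau = min {t | B_t = V(G)}, with value +oo if there is no such t *)
Definition prop_time (R : realType) (V : finType) (Omega : Type)
    (B : nat -> Omega -> {set V}) (x : Omega) : \bar R :=
  ereal_inf [set (t%:R)%:E | t in [set t : nat | B t x = finset.setT]]%classic.

Definition ept (R : realType) (V : finType) (d : measure_display)
    (Omega : measurableType d) (P : probability Omega R)
    (B : nat -> Omega -> {set V}) : \bar R :=
  if (0 < P [set x | exists t : nat, B t x = finset.setT]%classic)%E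
  then (\int[P]_x prop_time R B x)%E
  else +oo%E.

(* The rest of the file shows that rzf_process is never vacuous. A chain with
   transition matrix q is driven by one uniform variable u in [0, 1[: from the
   state a, the unit interval is cut into consecutive intervals of lengths
   q a b, the next state is the b whose interval contains u, and u is rescaled
   from that interval to [0, 1[. A finite history then has as preimage an
   interval whose length is the product of its transition probabilities. *)
Section chain.
Variables (R : realType) (T : finType) (q : T -> T -> R).
Hypothesis q0 : forall a b, 0 <= q a b.
Hypothesis q1 : forall a, \sum_b q a b = 1.

Let e := enum T.
Let f (a : T) (i : nat) := q a (nth a e i).
Let F (a : T) (n : nat) := \sum_(0 <= i < n) f a i.
Let lo a b := F a (index b e).

Let FS a b : F a (index b e).+1 = lo a b + q a b.
Proof. by rewrite /F big_nat_recr //= /f nth_index // mem_enum. Qed.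

Let F_mono a m n : (m <= n)%N -> F a m <= F a n.
Proof.
move=> mn; rewrite /F [leRHS](big_cat_nat (leq0n m) mn) //= lerDl sumr_ge0 // => i _.
exact: q0.
Qed.

Let Fsize a : F a (size e) = 1.
Proof. by rewrite /F /f -(big_nth a xpredT (q a)) /e big_enum /= q1. Qed.

Let cover a n u : 0 <= u < F a n -> exists2 k, (k < n)%N & F a k <= u < F a k.+1.
Proof.
elim: n => [|n IH].
  by rewrite /F big_nil; case/andP => u0 /(le_lt_trans u0); rewrite ltxx.
case/andP => u0 un; have [uF|Fu] := ltP u (F a n).
  by have [|k kn hk] := IH; [rewrite u0 | exists k => //; apply: ltnW].
by exists n => //; rewrite Fu.
Qed.

Let nxt a u := odflt a [pick b | lo a b <= u < lo a b + q a b].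

Let nxtP a b u : 0 <= u < 1 -> (nxt a u = b) <-> (lo a b <= u < lo a b + q a b).
Proof.
move=> u01.
have uniqc b' c : lo a b' <= u < lo a b' + q a b' ->
    lo a c <= u < lo a c + q a c -> b' = c.
  rewrite -!FS => /andP[h1 h2] /andP[h3 h4].
  have [lt|lt|eq] := ltngtP (index b' e) (index c e).
  - by move: (lt_le_trans h2 (F_mono a lt)); rewrite ltNge h3.
  - by move: (lt_le_trans h4 (F_mono a lt)); rewrite ltNge h1.
  - by rewrite -(nth_index a (_ : b' \in e)) ?mem_enum // eq nth_index ?mem_enum.
have [k ke hk] : exists2 k, (k < size e)%N & F a k <= u < F a k.+1.
  by apply: cover; rewrite Fsize.
have hk' : lo a (nth a e k) <= u < lo a (nth a e k) + q a (nth a e k).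
  by rewrite -FS /lo index_uniq // enum_uniq.
rewrite /nxt; case: pickP => [c hc|/(_ (nth a e k))]; last by rewrite hk'.
split=> /= [<-|hb] //; exact: uniqc hb.
Qed.

Fixpoint tr (t : nat) (a : T) (u : R) : T :=
  if t is t'.+1 then let b := nxt a u in tr t' b ((u - lo a b) / q a b) else a.

Lemma tr_itv t (A : nat -> T) :
  exists x, [/\ 0 <= x, x + \prod_(i < t) q (A i) (A i.+1) <= 1 &
   forall u, 0 <= u < 1 ->
    (forall s, (s <= t)%N -> tr s (A 0%N) u = A s) <->
    x <= u < x + \prod_(i < t) q (A i) (A i.+1)].
Proof.
elim: t A => [|t IH] A.
  exists 0; rewrite big_ord0 add0r; split=> // u u01; split=> // _ s.
  by rewrite leqn0 => /eqP ->.
have [y [y0 y1 yP]] := IH (fun n => A n.+1).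
set w := \prod_(i < t) _ in y1 yP.
have w0 : 0 <= w by apply: prodr_ge0.
set a := A 0%N; set b := A 1%N.
have lo0 : 0 <= lo a b by apply: sumr_ge0 => i _; exact: q0.
have lo1 : lo a b + q a b <= 1.
  rewrite -FS -(Fsize a); apply: F_mono.
  by rewrite index_mem mem_enum.
rewrite big_ord_recl -/w.
have tr_split u : (forall s, (s <= t.+1)%N -> tr s a u = A s) <->
   nxt a u = b /\ forall s, (s <= t)%N -> tr s b ((u - lo a b) / q a b) = A s.+1.
  split=> [h|[h1 h2] [|s] st //=].
    have h1 : nxt a u = b by move: (h 1%N isT).
    by split=> // s st; have := h s.+1 st; rewrite /= h1.
  by rewrite h1 h2.
have [q00|qn0] := eqVneq (q a b) 0.
  exists 0; split=> //=.
    by rewrite -/a -/b q00 mul0r addr0.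
  move=> u u01; rewrite tr_split nxtP // -/a -/b q00 mul0r !addr0; split.
    by case=> /andP[h1 h2]; move: (le_lt_trans h1 h2); rewrite ltxx.
  by case/andP=> h1 h2; move: (le_lt_trans h1 h2); rewrite ltxx.
have qp : 0 < q a b by rewrite lt_neqAle eq_sym qn0 q0.
exists (lo a b + q a b * y); split=> /=.
- by rewrite addr_ge0 // mulr_ge0 // ltW.
- rewrite -addrA -mulrDr; apply: le_trans lo1; rewrite lerD2l.
  by rewrite -[leRHS]mulr1 ler_pM2l.
move=> u u01; rewrite tr_split nxtP // -/a -/b.
set v := (u - lo a b) / q a b.
have uE : u = lo a b + q a b * v.
  by rewrite /v mulrC -mulrA mulVf // mulr1 addrC subrK.
have -> : (lo a b <= u < lo a b + q a b) = (0 <= v < 1).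
  by rewrite uE lerDl pmulr_rge0 // ltrD2l gtr_pMr.
rewrite {1 2}uE -addrA -mulrDr lerD2l ltrD2l ler_pM2l // ltr_pM2l //.
split=> [[v01 /(yP _ v01)] //|hv].
have v01 : 0 <= v < 1.
  by case/andP: hv => h1 h2; rewrite (le_trans y0 h1) (lt_le_trans h2 y1).
by split=> //; apply/(yP _ v01).
Qed.

End chain.

Section existence.
Variables (R : realType) (V : finType) (G : wdigraph R V) (S : {set V}).

Let p0 B v : 0 <= rzf_prob G B v.
Proof.
rewrite /rzf_prob; case: ifP => // h.
by rewrite divr_ge0 // ?sumr_ge0 ?(ltW h) // => u _; exact: weight_ge0.
Qed.

Let p1 B v : rzf_prob G B v <= 1.
Proof.
rewrite /rzf_prob; case: ifP => // h; rewrite ler_pdivrMr // mul1r.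
rewrite [leRHS](bigID (mem B)) /= lerDl sumr_ge0 // => u _.
exact: weight_ge0.
Qed.

Let q0 B B' : 0 <= rzf_trans G B B'.
Proof.
rewrite /rzf_trans; case: ifP => // _; apply: prodr_ge0 => v _.
by case: ifP => // _; rewrite subr_ge0.
Qed.

Let q1 B : \sum_B' rzf_trans G B B' = 1.
Proof.
pose f v := if v \in B then 1 else rzf_prob G B v.
transitivity (\prod_v (f v + (1 - f v))); last first.
  by rewrite big1 // => v _; rewrite addrC subrK.
rewrite bigA_distr; apply: eq_bigr => B' _; rewrite /rzf_trans.
case: ifPn => [sBB'|/fintype.subsetPn[v vB vB']].
  rewrite [RHS](bigID (mem B)) /= [X in _ = X * _]big1 ?mul1r => [|v vB]; last first.
    by rewrite (fintype.subsetP sBB') // /f vB.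
  apply: eq_big => v; rewrite ?inE // => vB; by rewrite /f (negbTE vB).
by rewrite (bigD1 v) //= (negbTE vB') /f vB subrr mul0r.
Qed.

Let D : set (measurableTypeR R) := `[0, 1[%classic.
Let mD : measurable D. Proof. exact: measurable_itv. Qed.

Let unif : {measure set (measurableTypeR R) -> \bar R} :=
  mrestr (@lebesgue_measure R) mD.

Let unif1 : unif [set: measurableTypeR R]%classic = 1%E.
Proof. by rewrite /unif /= /mrestr setTI /D lebesgue_measure_itv /= lte_fin ltr01 sube0. Qed.

Let P : probability (measurableTypeR R) R :=
  HB.pack (Measure.sort unif) (Measure.class unif) (@Measure_isProbability.Build _ _ _ unif unif1).

Let B (t : nat) (u : measurableTypeR R) : {set V} :=
  if 0 <= u < 1 then tr (rzf_trans G) t S u else S.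

Let cyl t (A : nat -> {set V}) :=
  ([set x | forall s, (s <= t)%N -> B s x = A s] `&` D)%classic.

Let DP u : D u <-> 0 <= u < 1. Proof. by rewrite /D /= in_itv. Qed.

Let cylP t A : measurable (cyl t A) /\
  lebesgue_measure (cyl t A) =
  (if A 0%N == S then \prod_(i < t) rzf_trans G (A i) (A i.+1) else 0)%:E.
Proof.
have [AS|nAS] := eqVneq (A 0%N) S; last first.
  have -> : cyl t A = set0.
    apply/seteqP; split=> // u [h /DP u01]; move/eqP: nAS; apply.
    by rewrite -(h 0%N) // /B u01.
  by rewrite measure0.
have [x [x0 x1 xP]] := tr_itv q0 q1 t A.
set w := \prod_(i < t) _ in x1 xP *.
have w0 : 0 <= w by apply: prodr_ge0.
have -> : cyl t A = `[x, x + w[%classic.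
  apply/seteqP; split=> u.
    case=> h /DP u01; rewrite /= in_itv /=; apply/(xP _ u01) => s st.
    by have := h s st; rewrite /B u01 -AS.
  rewrite /= in_itv /= => hu.
  have u01 : 0 <= u < 1.
    by case/andP: hu => h1 h2; rewrite (le_trans x0 h1) (lt_le_trans h2 x1).
  split; last exact/DP.
  by move=> s st; rewrite /B u01 -AS; apply: (xP _ u01).2.
split; first exact: measurable_itv.
rewrite lebesgue_measure_itv /= lte_fin ltrDl; case: ltP => [_|w0'].
  by rewrite -EFinB addrC addKr.
by congr EFin; apply: le_anti; rewrite w0.
Qed.

Lemma rzf_process_exists :
  exists (d : measure_display) (Omega : measurableType d)
    (P : probability Omega R) (B : nat -> Omega -> {set V}),
    rzf_process G S P B.
Proof.
exists _, (measurableTypeR R), P, B; split.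
- move=> t A.
  pose ext (h : {ffun 'I_t.+1 -> {set V}}) s := h (inord s).
  have -> : [set x | B t x = A]%classic =
     ((\bigcup_(h in [set h | ext h t = A]) cyl t (ext h)) `|`
      (if S == A then ~` D else set0))%classic.
    apply/seteqP; split=> u /=.
      move=> BA; have [Du|nDu] := pselect (D u); last first.
        right; have [u01|nu01] := boolP (0 <= u < 1).
          by exfalso; apply: nDu; apply/DP.
        by rewrite -BA /B (negbTE nu01) eqxx.
      left; exists [ffun i : 'I_t.+1 => B i u].
        by rewrite /= /ext ffunE inordK.
      by split=> // s st; rewrite /ext ffunE inordK.
    case=> [[h /= <- [hu _]]|]; first exact: hu.
    case: eqP => // <- nDu; rewrite /B; case: ifP => // u01; exfalso; apply: nDu; apply/DP.
  apply: measurableU.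
    apply: fin_bigcup_measurable => [|h _]; first exact: finite_finset.
    exact: (cylP _ _).1.
  by case: ifP => // _; exact: measurableC.
- by move=> x; rewrite /B /=; case: ifP.
- move=> t A.
  have PE n : P [set x | forall s, (s <= n)%N -> B s x = A s]%classic =
      (if A 0%N == S then \prod_(i < n) rzf_trans G (A i) (A i.+1) else 0)%:E.
    exact: (cylP n A).2.
  rewrite !PE -EFinM; congr EFin; case: ifP => _; last by rewrite mul0r.
  by rewrite big_ord_recr.
Qed.

End existence.

(* Main.v *)
(** The law of the first hitting time of [V] is governed by one-step operators:
    the probability that round [t] is reached with some vertex still white
    satisfies [u_0(S) = [S <> V]] and
    [u_(t+1)(S) = [S <> V] * sum_B' q(S, B') u_t(B')]. One round from [S] turns
    each vertex blue independently, with a probability (1 for the vertices of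
    [S]) which is nondecreasing in [S]; changing these Bernoulli parameters one
    vertex at a time shows that the round operator maps antitone functions of
    the blue set to antitone functions, so every [u_t] is antitone. The expected
    propagation time is the sum of the [u_t(S)]. *)
Require Import Defs.
From HB Require Import structures.
From mathcomp Require Import all_boot all_order all_algebra.
From mathcomp Require Import all_classical all_reals all_analysis.
From mathcomp Require Import ring measurable_realfun.

Set Implicit Arguments.
Unset Strict Implicit.
Unset Printing Implicit Defensive.

Import Order.TTheory GRing.Theory Num.Theory.
Local Open Scope ring_scope.

(** * Means over independent Bernoulli variables and their monotonicity in the parameters *)

Section bernoulli_product.
Variables (R : realType) (V : finType).
Implicit Types (f : V -> R) (g : {set V} -> R).

Definition bernoulli_mean f g : R :=
  \sum_(B : {set V}) (\prod_v (if v \in B then f v else 1 - f v)) * g B.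

Definition antitone g := forall A B : {set V}, A \subset B -> g B <= g A.

(** Pairing each [B] avoiding [w] with [w |: B] isolates the dependence on [f w]: the mean is affine
    in this single parameter. *)
Lemma bernoulli_mean_split f g w :
  bernoulli_mean f g =
  \sum_(B : {set V} | w \notin B)
    (\prod_(v | v != w) (if v \in B then f v else 1 - f v)) *
    (f w * g (w |: B) + (1 - f w) * g B).
Proof.
rewrite /bernoulli_mean (bigID (fun B : {set V} => w \in B)) /=.
rewrite (reindex_onto (fun B => w |: B) (fun B => B :\ w)) /=; last first.
  by move=> B wB; rewrite finset.setD1K.
rewrite (eq_bigl (fun B : {set V} => w \notin B)); last first.
  move=> B; rewrite setU11 /=; apply/eqP/idP => [<-|wB]; first by rewrite !inE eqxx.
  by rewrite setU1K.
rewrite -big_split; apply: eq_bigr => B wB /=.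
rewrite (bigD1 w) //= setU11 [X in _ + X * _](bigD1 w) //= (negbTE wB).
rewrite [X in _ * X * _](eq_bigr (fun v => if v \in B then f v else 1 - f v)).
  by rewrite mulrDr !mulrA ![\prod_(i | _) _ * _]mulrC.
by move=> v vw; rewrite in_setU1 (negbTE vw).
Qed.

(** After the split at [w], the two sides have the same nonnegative weights, and each bracket drops
    by [(f' w - f w) * (g B - g (w |: B))]. *)
Lemma le_bernoulli_mean1 f f' g w :
  (forall v, 0 <= f v <= 1) -> (forall v, v != w -> f' v = f v) ->
  f w <= f' w -> antitone g -> bernoulli_mean f' g <= bernoulli_mean f g.
Proof.
move=> f01 ff' fw ag; rewrite !(bernoulli_mean_split _ _ w).
apply: ler_sum => B wB.
under eq_bigr => v vw do rewrite ff' //.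
apply: ler_wpM2l.
  apply: prodr_ge0 => v _; case/andP: (f01 v) => f0 f1.
  by case: ifP => // _; rewrite subr_ge0.
rewrite -subr_ge0.
have -> : f w * g (w |: B) + (1 - f w) * g B -
    (f' w * g (w |: B) + (1 - f' w) * g B) =
    (f' w - f w) * (g B - g (w |: B)) by ring.
by rewrite mulr_ge0 // subr_ge0 // ag // finset.subsetUr.
Qed.

Lemma le_bernoulli_mean f f' g :
  (forall v, 0 <= f v) -> (forall v, f v <= f' v) -> (forall v, f' v <= 1) ->
  antitone g -> bernoulli_mean f' g <= bernoulli_mean f g.
Proof.
move=> f0 ff' f1 ag.
(* Hybrid parameters: [h [::]] is [f] and [h (enum V)] is [f']; adding one vertex to [s] alters at
   most one parameter. *)
pose h (s : seq V) v := if v \in s then f' v else f v.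
suff H s : bernoulli_mean (h s) g <= bernoulli_mean f g.
  apply: le_trans (H (enum V)); rewrite le_eqVlt; apply/orP; left; apply/eqP.
  by congr bernoulli_mean; apply/funext => v; rewrite /h mem_enum.
elim: s => [|w s IH]; first exact: lexx.
apply: le_trans IH; apply: (@le_bernoulli_mean1 _ _ _ w) => // [v|v vw|].
- by rewrite /h; case: ifP => _; rewrite ?f0 ?f1 ?(le_trans (f0 v) (ff' v))
    ?(le_trans (ff' v) (f1 v)).
- by rewrite /h inE (negbTE vw).
- by rewrite /h inE eqxx /=; case: ifP.
Qed.

End bernoulli_product.

(** * One round of forcing as a product measure, and its iterates *)

Section transition.
Variables (R : realType) (V : finType) (G : wdigraph R V).
Implicit Types (A B : {set V}) (g : {set V} -> R).

Definition blue_prob B v : R := if v \in B then 1 else rzf_prob G B v.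

Lemma rzf_prob_ge0 B v : 0 <= rzf_prob G B v.
Proof.
rewrite /rzf_prob; case: ifP => // h.
by rewrite divr_ge0 // ?sumr_ge0 ?(ltW h) // => u _; exact: weight_ge0.
Qed.

(** The denominator does not depend on the blue set, and the numerator gains only nonnegative
    weights. *)
Lemma le_rzf_prob A B v : A \subset B -> rzf_prob G A v <= rzf_prob G B v.
Proof.
move=> AB; rewrite /rzf_prob; case: ifP => // h.
rewrite ler_wpM2r ?invr_ge0 ?(ltW h) //.
rewrite [leRHS](bigID (mem A)) /=.
rewrite [X in _ <= X + _](eq_bigl (mem A)) => [|u]; last first.
  by apply/andP/idP => [[]//|uA]; split=> //; exact: (fintype.subsetP AB).
by rewrite lerDl sumr_ge0 // => u _; exact: weight_ge0.
Qed.

Lemma rzf_prob_le1 B v : rzf_prob G B v <= 1.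
Proof.
apply: le_trans (le_rzf_prob v (finset.subsetT B)) _; rewrite /rzf_prob; case: ifP => // h.
by rewrite (eq_bigl xpredT) ?divff ?gt_eqF // => u; rewrite inE.
Qed.

Lemma blue_prob_ge0 B v : 0 <= blue_prob B v.
Proof. by rewrite /blue_prob; case: ifP => // _; exact: rzf_prob_ge0. Qed.

Lemma blue_prob_le1 B v : blue_prob B v <= 1.
Proof. by rewrite /blue_prob; case: ifP => // _; exact: rzf_prob_le1. Qed.

Lemma le_blue_prob A B v : A \subset B -> blue_prob A v <= blue_prob B v.
Proof.
move=> AB; have [vB|vB] := boolP (v \in B).
  by rewrite {2}/blue_prob vB blue_prob_le1.
rewrite /blue_prob (negbTE vB) (contraNF (fintype.subsetP AB v) vB).
exact: le_rzf_prob.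
Qed.

(** With parameter 1 on [A], the product ranges over all of [V] and absorbs the case split: a vertex
    of [A] outside [B] contributes the factor [1 - 1]. *)
Lemma rzf_transE A B :
  rzf_trans G A B = \prod_v (if v \in B then blue_prob A v else 1 - blue_prob A v).
Proof.
rewrite /rzf_trans; case: ifPn => [sAB|/fintype.subsetPn[v vA vB]].
  rewrite [RHS](bigID (mem A)) /= [X in _ = X * _]big1 ?mul1r => [|v vA]; last first.
    by rewrite (fintype.subsetP sAB) // /blue_prob vA.
  by apply: eq_big => v; rewrite ?inE // => vA; rewrite /blue_prob (negbTE vA).
by rewrite (bigD1 v) //= (negbTE vB) /blue_prob vA subrr mul0r.
Qed.

Lemma rzf_trans_ge0 A B : 0 <= rzf_trans G A B.
Proof.
rewrite rzf_transE prodr_ge0 // => v _.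
by case: ifP => _; rewrite ?subr_ge0 ?blue_prob_ge0 ?blue_prob_le1.
Qed.

Lemma rzf_trans_meanE A g :
  \sum_B rzf_trans G A B * g B = bernoulli_mean (blue_prob A) g.
Proof. by apply: eq_bigr => B _; rewrite rzf_transE. Qed.

Lemma antitone_rzf_trans g :
  antitone g -> antitone (fun A => \sum_B rzf_trans G A B * g B).
Proof.
move=> ag A A' AA'; rewrite !rzf_trans_meanE; apply: le_bernoulli_mean => // v; first exact: blue_prob_ge0.
  exact: le_blue_prob.
exact: blue_prob_le1.
Qed.

(* the probability, starting from [A], of not being all blue in rounds 0, ..., t *)
Fixpoint survival (t : nat) A : R :=
  if A == finset.setT then 0
  else if t is t'.+1 then \sum_B rzf_trans G A B * survival t' B else 1.

Lemma survivalT t : survival t finset.setT = 0.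
Proof. by case: t => [|t] /=; rewrite eqxx. Qed.

Lemma survival_ge0 t A : 0 <= survival t A.
Proof.
elim: t A => [|t IH] A /=; case: ifP => // _.
by apply: sumr_ge0 => B _; rewrite mulr_ge0 // rzf_trans_ge0.
Qed.

(** If the larger set is full, its value is 0; otherwise neither set is full and both sides unfold
    to the same recursion. *)
Lemma antitone_survival t : antitone (survival t).
Proof.
elim: t => [|t IH] A B AB; have [->|BT] := eqVneq B finset.setT;
  rewrite ?survivalT ?survival_ge0 //=; have AT : A != finset.setT by
    apply: contraNneq BT => AT; rewrite -finset.subTset -AT.
  by rewrite (negbTE AT) (negbTE BT).
by rewrite (negbTE AT) (negbTE BT); exact: antitone_rzf_trans.
Qed.

End transition.

(** Converts the finitely supported sum produced by additivity of a measure into a sum over a finite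
    type. *)
Lemma fsbig_setT (R : Type) (idx : R) (op : Monoid.com_law idx) (T : finType)
    (F : T -> R) :
  \big[op/idx]_(i \in [set: T]%classic) F i = \big[op/idx]_i F i.
Proof.
rewrite (@bigfs _ idx op T _ xpredT F (index_enum_uniq T)) => [|i _]; last first.
  by rewrite mem_index_enum.
by congr bigop; congr finite_support; apply/seteqP; split.
Qed.

(** * From an arbitrary realization of the process to the survival function *)

Section process.
Variables (R : realType) (V : finType) (G : wdigraph R V) (S : {set V}).
Variables (d : measure_display) (Omega : measurableType d).
Variables (P : probability Omega R) (B : nat -> Omega -> {set V}).
Hypothesis rzfB : rzf_process G S P B.
Local Open Scope classical_set_scope.

Definition unfinished (t : nat) : set Omega :=
  [set x | forall s, (s <= t)%N -> B s x != finset.setT].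

Let history (t : nat) (h : nat -> {set V}) : set Omega :=
  [set x | forall s, (s <= t)%N -> B s x = h s].

(** The window starts at [t], so that an induction on [k] can restart one round later. *)
Let white_in (t k : nat) : set Omega :=
  [set x | forall s, (t <= s <= t + k)%N -> B s x != finset.setT].

Let measurable_rounds (I : set nat) (Q : nat -> {set V} -> Prop) :
  measurable [set x | forall s, I s -> Q s (B s x)].
Proof.
rewrite (_ : [set _ | _] =
  \bigcap_(s in I) \bigcup_(A in [set A | Q s A]) [set x | B s x = A]).
  apply: bigcap_measurableType => s _.
  apply: fin_bigcup_measurable => [|A _]; first exact: finite_finset.
  exact: rzf_measurable rzfB _ _.
apply/seteqP; split=> x /= h s Is; first by exists (B s x) => //; exact: h.
by have [A QA /= ->] := h s Is.
Qed.

Lemma measurable_unfinished t : measurable (unfinished t).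
Proof. exact: (measurable_rounds [set s | s <= t]%N (fun _ A => A != finset.setT)). Qed.

Let measurable_history t h : measurable (history t h).
Proof. exact: (measurable_rounds [set s | s <= t]%N (fun s A => A = h s)). Qed.

Let measurable_white_in t k : measurable (white_in t k).
Proof.
exact: (measurable_rounds [set s | t <= s <= t + k]%N (fun _ A => A != finset.setT)).
Qed.

Let extend t (h : nat -> {set V}) A s := if (s <= t)%N then h s else A.

Let history_extend t h A x :
  history t.+1 (extend t h A) x <-> history t h x /\ B t.+1 x = A.
Proof.
rewrite /history /extend /=; split=> [H|[H <-] s].
  split=> [s st|]; first by rewrite H ?st // ltnW.
  by rewrite H // ltnn.
by rewrite leq_eqVlt ltnS => /predU1P[->|st]; rewrite ?ltnn // st H.
Qed.

(** Markov property: given the history, survival for [k] more rounds depends only on [h t]. The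
    induction on [k] must vary [t] and [h], since it conditions on the state at round [t.+1]. *)
Let prob_history_white t k h :
  P (history t h `&` white_in t k) = (P (history t h) * (survival G k (h t))%:E)%E.
Proof.
elim: k t h => [|k IH] t h; have [hT|hT] := eqVneq (h t) finset.setT.
- rewrite hT survivalT mule0 (_ : _ `&` _ = set0) ?measure0 //.
  apply/seteqP; split=> // x [/(_ t (leqnn t)) Bh /(_ t)].
  by rewrite Bh hT eqxx addn0 leqnn => /(_ isT).
- rewrite /= (negbTE hT) mule1; congr (P _); apply/setIidl => x Hx s.
  by rewrite addn0 -eqn_leq => /eqP <-; rewrite Hx.
- rewrite hT survivalT mule0 (_ : _ `&` _ = set0) ?measure0 //.
  apply/seteqP; split=> // x [/(_ t (leqnn t)) Bh /(_ t)].
  by rewrite Bh hT eqxx leqnn leq_addr => /(_ isT).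
- rewrite /= (negbTE hT).
  pose F A := history t.+1 (extend t h A) `&` white_in t.+1 k.
  have -> : history t h `&` white_in t k.+1 = \bigcup_(A in setT) F A.
    apply/seteqP; split=> x.
      case=> Hx Wx; exists (B t.+1 x) => //; split; first exact/history_extend.
      by move=> s /andP[ts st]; apply: Wx; rewrite ltnW // -addSnnS.
    case=> A _ [/history_extend[Hx _] Wx]; split=> // s /andP[].
    (* Round [t] lies outside the later window; there the history gives [h t], which is not full. *)
    rewrite leq_eqVlt => /predU1P[<- _|ts st]; first by rewrite Hx.
    by apply: Wx; rewrite ts addSnnS.
  rewrite measure_fin_bigcup //=; last 2 first.
  - apply/trivIsetP => A A' _ _ AA'; apply/seteqP; split=> // x.
    case=> [[/history_extend[_ BA] _] [/history_extend[_ BA'] _]].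
    by move/eqP: AA'; apply; rewrite -BA.
  - by move=> A _; apply: measurableI.
  rewrite fsbig_setT -sumEFin ge0_sume_distrr; last first.
    by move=> A _; rewrite lee_fin mulr_ge0 ?rzf_trans_ge0 ?survival_ge0.
  apply: eq_bigr => A _; rewrite /F IH {2}/extend ltnn EFinM muleA.
  congr (_ * _)%E; rewrite /history (rzf_step rzfB) /extend leqnn ltnn.
  congr (P _ * _)%E; apply/seteqP; split=> x H s st; by rewrite H // st.
Qed.

Lemma prob_unfinished t : P (unfinished t) = (survival G t S)%:E.
Proof.
have := prob_history_white 0 t (fun=> S).
have -> : history 0 (fun=> S) = setT.
  by apply/seteqP; split=> // x _ s; rewrite leqn0 => /eqP ->; exact: rzf_init rzfB x.
by rewrite setTI probability_setT mul1e => <-; congr (P _).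
Qed.

(** Tail-sum formula, pointwise: the hitting time counts the rounds [t] that it exceeds. *)
Lemma prop_timeE x :
  prop_time R B x = (\sum_(0 <= t <oo) (\1_(unfinished t) x)%:E)%E.
Proof.
have ind0 t : (0 <= (\1_(unfinished t) x : R)%:E)%E by rewrite lee_fin.
have [hit|nohit] := pselect (exists t, B t x == finset.setT); last first.
  have un t : \1_(unfinished t) x = 1 :> R.
    rewrite indicE mem_set // => s _; apply/negP => Bs; apply: nohit; by exists s.
  rewrite /prop_time (_ : [set _ | t in _] = set0) ?ereal_inf0; last first.
    apply/seteqP; split=> // _ [t /= Bt _]; apply: nohit; exists t; exact/eqP.
  (* Without a hit every term is 1, so the partial sums pass any real [r]. *)
  apply/esym/eqyP => r r0.
  apply: le_trans (nneseries_lim_ge (Num.bound r) (fun n _ _ => ind0 n)).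
  under eq_bigr do rewrite un.
  rewrite sumEFin lee_fin sumr_const_nat subn0.
  by apply/ltW; have := archi_boundP (ltW r0).
pose n := ex_minn hit.
have [Bn nmin] : B n x == finset.setT /\ forall t, B t x == finset.setT -> (n <= t)%N.
  by rewrite /n; case: ex_minnP.
have un t : \1_(unfinished t) x = (t < n)%N%:R :> R.
  rewrite indicE; congr (_%:R); congr nat_of_bool; apply/idP/idP.
    by rewrite inE ltnNge => U; apply/negP => /U; rewrite Bn.
  move=> tn; rewrite inE => s st; apply/negP => /nmin ns.
  by have := leq_trans tn (leq_trans ns st); rewrite ltnn.
rewrite (nneseries_split _ n) ?add0n // eseries0 ?adde0; last first.
  by move=> i ni _; rewrite un ltnNge ni.
rewrite big_nat (eq_bigr (fun=> 1%E)); last by move=> i /andP[_ ti]; rewrite un ti.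
rewrite -big_nat sumEFin sumr_const_nat subn0.
apply/eqP; rewrite eq_le; apply/andP; split.
  by apply: ereal_inf_lbound; exists n => //; exact/eqP.
apply: le_ereal_inf_tmp => _ [t /= Bt <-]; rewrite lee_fin ler_nat.
by apply: nmin; rewrite Bt.
Qed.

(** The terms are nonnegative, so integral and series commute. *)
Lemma integral_prop_time :
  (\int[P]_x prop_time R B x = \sum_(0 <= t <oo) (survival G t S)%:E)%E.
Proof.
under eq_integral do rewrite prop_timeE.
rewrite integral_nneseries //.
  apply: eq_eseriesr => t _; rewrite integral_indic //.
    by rewrite setIT; exact: prob_unfinished.
  exact: measurable_unfinished.
move=> t; apply/measurable_EFinP/measurable_indic; exact: measurable_unfinished.
Qed.

(** Finishing is the countable union of the complements of [unfinished t], so it has positive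
    probability exactly when one of them does. *)
Lemma finish_prob_gt0 :
  (0 < P [set x | exists t, B t x = finset.setT])%E <->
  exists t, survival G t S < 1.
Proof.
have -> : [set x | exists t, B t x = finset.setT] = \bigcup_t ~` unfinished t.
  apply/seteqP; split=> x.
    by case=> t Bt; exists t => // /(_ t (leqnn t)); rewrite Bt eqxx.
  case=> t _ /existsNP[s] /not_implyP[_ /negP]; rewrite negbK => /eqP Bs.
  by exists s.
have mC t : measurable (~` unfinished t) by exact/measurableC/measurable_unfinished.
have PC t : P (~` unfinished t) = (1 - survival G t S)%:E.
  by rewrite probability_setC ?prob_unfinished //; exact: measurable_unfinished.
split=> [P0|[t ut]].
  apply: contrapT => /forallNP nt; move: P0; rewrite (_ : P _ = 0%E) ?ltxx //.
  apply/negligibleP; first exact: bigcup_measurable.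
  apply: negligible_bigcup => t; apply/negligibleP => //.
  apply: (etrans (PC t)); congr EFin; apply/eqP; rewrite eq_le subr_le0 subr_ge0.
  (* The bound [survival G t S <= 1] holds because this number is a probability. *)
  rewrite leNgt (introN idP (nt t)) /= -lee_fin -prob_unfinished.
  exact/probability_le1/measurable_unfinished.
have P0 : (0 < P (~` unfinished t))%E by rewrite PC lte_fin subr_gt0.
apply: lt_le_trans P0 _; apply: le_measure; rewrite ?inE //.
  exact: bigcup_measurable.
by move=> x Ux; exists t.
Qed.

End process.

Theorem corollary2p2 (R : realType) (V : finType) (G : wdigraph R V)
    (S1 S2 : {set V}) (sS12 : S1 \subset S2)
    (d1 d2 : measure_display)
    (Omega1 : measurableType d1) (Omega2 : measurableType d2)
    (P1 : probability Omega1 R) (P2 : probability Omega2 R)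
    (B1 : nat -> Omega1 -> {set V}) (B2 : nat -> Omega2 -> {set V})
    (rzf1 : rzf_process G S1 P1 B1) (rzf2 : rzf_process G S2 P2 B2) :
  (ept P1 B1 >= ept P2 B2)%E.
Proof.
have le_survival t : survival G t S2 <= survival G t S1 by exact: antitone_survival.
rewrite /ept; case: ifPn => [_|h2]; case: ifPn => [h1|_]; rewrite ?leey //.
  rewrite (integral_prop_time rzf1) (integral_prop_time rzf2).
  by apply: lee_nneseries => t _ //; rewrite lee_fin ?survival_ge0.
(* Remaining case: [S1] can finish but [S2] cannot. A round with survival below 1 from [S1] also
   serves for [S2]. *)
case/negP: h2; apply/(finish_prob_gt0 rzf2).
have [t ut] := (finish_prob_gt0 rzf1).1 h1.
by exists t; exact: le_lt_trans ut.
Qed.
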